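(* Let $A\subseteq\mathbb{R}$ be an open invex set with respect to $\eta:A\times A\to\mathbb{R}$ and let $a,b\in A$ with $a<a+\eta(b,a)$. Let $f:A\to\mathbb{R}$ be differentiable with $f'\in L[a,a+\eta(b,a)]$, and suppose $|f'|$ is preinvex on $A$. Then for every $\alpha>0$, \[ \left|\frac{f(a)+f(a+\eta(b,a))}{2}-\frac{\Gamma(\alpha+1)}{2\eta^{\alpha}(b,a)}\Big[J_{a^+}^{\alpha}f\big(a+\eta(b,a)\big)+J_{(a+\eta(b,a))^-}^{\alpha}f(a)\Big]\right|\le\frac{\eta(b,a)}{2(\alpha+1)}\left(1-\frac{1}{2^{\alpha}}\right)\big[|f'(a)|+|f'(b)|\big]. \]
   Context: A set $A\subseteq\mathbb{R}$ is invex with respect to $\eta:A\times A\to\mathbb{R}$ if $x+t\eta(y,x)\in A$ for all $x,y\in A$ and $t\in[0,1]$. A function $g$ on an invex set $A$ is preinvex with respect to $\eta$ if $g(x+t\eta(y,x))\le(1-t)g(x)+tg(y)$ for all $x,y\in A$, $t\in[0,1]$. For $g\in L[c,d]$ and $\alpha>0$, the Riemann–Liouville fractional integrals are $J_{c^+}^{\alpha}g(x)=\frac{1}{\Gamma(\alpha)}\int_c^x(x-t)^{\alpha-1}g(t)\,dt$ for $x>c$ and $J_{d^-}^{\alpha}g(x)=\frac{1}{\Gamma(\alpha)}\int_x^d(t-x)^{\alpha-1}g(t)\,dt$ for $x<d$; $\eta^{\alpha}(b,a)=(\eta(b,a))^{\alpha}$. *)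

(* Defs.v *)
From HB Require Import structures.
From mathcomp Require Import all_boot all_order all_algebra.
From mathcomp Require Import all_classical all_reals all_analysis.
Set Implicit Arguments. Unset Strict Implicit. Unset Printing Implicit Defensive.
Import Order.TTheory GRing.Theory Num.Theory.
Import numFieldNormedType.Exports.
Local Open Scope classical_set_scope.
Local Open Scope ring_scope.

Section Defs.
Variable R : realType.

Definition invex (A : set R) (eta : R -> R -> R) : Prop :=
  forall x y, A x -> A y -> forall t : R, 0 <= t <= 1 -> A (x + t * eta y x).

Definition preinvex (A : set R) (eta : R -> R -> R) (g : R -> R) : Prop :=
  forall x y, A x -> A y -> forall t : R, 0 <= t <= 1 ->
    g (x + t * eta y x) <= (1 - t) * g x + t * g y.

Definition Gamma (a : R) : R :=
  Rintegral lebesgue_measure `]0, +oo[%classic (fun t => t `^ (a - 1) * expR (- t)).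

Definition RL_left (alpha : R) (g : R -> R) (c x : R) : R :=
  (Gamma alpha)^-1 *
  Rintegral lebesgue_measure `[c, x]%classic (fun t => (x - t) `^ (alpha - 1) * g t).

Definition RL_right (alpha : R) (g : R -> R) (d x : R) : R :=
  (Gamma alpha)^-1 *
  Rintegral lebesgue_measure `[x, d]%classic (fun t => (t - x) `^ (alpha - 1) * g t).

End Defs.

(* Main.v *)
(** Fold the two fractional integrals onto the weight [(s - a)^(alpha - 1)] by the
    reflection [s |-> 2a + h - s], where [h = eta(b, a)] and [d = a + h].  Up to
    constants the left-hand side is then the integral of this weight against
    [D s = f a + f d - f s - f (a + d - s)].  Preinvexity bounds [|f'|] on [[a, d]] by
    the derivative of a quadratic, so the mean value theorem alone (no fundamental
    theorem for [f']) gives [|D s| <= (|f' a| + |f' b|) min (s - a, d - s)].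
    Integrating this bound on the two halves of [[a, d]] yields the constant.
    [Gamma (p + 1) = p Gamma p] holds because [t^(p-1) e^(-t) (p - t)], the derivative
    of [t^p e^(-t)], integrates to zero; it changes sign only at [p], so monotone
    convergence applies on each side of [p]. *)
Require Import Defs.
From HB Require Import structures.
From mathcomp Require Import all_boot all_order all_algebra.
From mathcomp Require Import all_classical all_reals all_analysis.
From mathcomp Require Import measurable_realfun ring lra.
Import Order.TTheory GRing.Theory Num.Theory.
Import numFieldNormedType.Exports.
Local Open Scope classical_set_scope.
Local Open Scope ring_scope.

(** * Fundamental theorem of calculus with a singular left endpoint *)

(** Since [f] may blow up at [a], the classical theorem is used on compact intervals whose left end
    decreases to [a]. Monotone convergence passes to the limit on the integral side, right
    continuity of [F] on the other. *)
Lemma ge0_FTC2_oc (R : realType) (F f : R -> R) (a b : R) : a < b ->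
  (forall x, a < x <= b -> 0 <= f x) ->
  (forall x, a < x <= b -> {for x, continuous f}) ->
  (forall x, a < x <= b -> is_derive x 1 F (f x)) ->
  F x @[x --> a^'+] --> F a ->
  (\int[lebesgue_measure]_(x in `]a, b]) (f x)%:E = (F b - F a)%:E)%E.
Proof.
move=> ab f0 cf dF Fa.
(* The shift by 2 keeps [u 0] strictly below [b], so that no interval [[u n, b]] degenerates. *)
pose u (n : nat) : R := a + (b - a) * n.+2%:R^-1.
have au n : a < u n by rewrite ltrDl mulr_gt0 ?subr_gt0.
have ub n : u n < b.
  rewrite -ltrBrDl gtr_pMr ?subr_gt0// invf_lt1//.
  by rewrite ltr1n.
have u_a : u @ \oo --> a.
  rewrite -[X in _ --> X]addr0 -[X in _ --> _ + X](mulr0 (b - a)).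
  apply: cvgD; first exact: cvg_cst.
  apply: cvgMl_tmp.
  have := @cvg_harmonic R; rewrite -cvg_shiftS; exact: cvg_trans.
have -> : `]a, b]%classic = \bigcup_n `[u n, b]%classic.
  apply/seteqP; split => [x|x [n _]] /=; rewrite !in_itv/=; last first.
    by move=> /andP[unx ->]; rewrite (lt_le_trans (au n)).
  move=> /andP[ax xb].
  have /cvgr_lt/(_ _ ax) [N _ /(_ N (leqnn N)) uN] := u_a.
  by exists N => //=; rewrite in_itv/= ltW.
have cfn n : {within `[u n, b], continuous f}.
  apply: continuous_in_subspaceT => x; rewrite inE/= in_itv/= => /andP[ux xb].
  by apply: cf; rewrite xb (lt_le_trans (au n)).
have dFn n x : x \in `[u n, b] -> is_derive x 1 F (f x).
  by rewrite in_itv/= => /andP[ux xb]; apply: dF; rewrite xb (lt_le_trans (au n)).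
have intE n : (\int[lebesgue_measure]_(x in `[u n, b]) (f x)%:E =
    (F b - F (u n))%:E)%E.
  rewrite (@continuous_FTC2 _ f F) ?EFinB//.
  - have cF : {within `[u n, b], continuous F}.
      by apply: derivable_within_continuous => x /(dFn n)[].
    have /continuous_within_itvP := cF.
    move=> /(_ (ub n))[_ ? ?]; split => //.
    by move=> x /subset_itv_oo_cc /(dFn n)[].
  - move=> x /subset_itv_oo_cc /(dFn n) ?.
    by rewrite derive1E derive_val.
have h := @ge0_nondecreasing_set_cvg_integral _ (measurableTypeR R) R
  (fun n => `[u n, b]%classic) (EFin \o f) (@lebesgue_measure R).
have {h} /cvg_lim <- // : (\int[lebesgue_measure]_(x in `[u n, b]) (f x)%:E
    @[n --> \oo] --> \int[lebesgue_measure]_(x in \bigcup_n `[u n, b]%classic) (f x)%:E)%E.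
  apply: h => //.
  - apply/nondecreasing_seqP => n; apply/subsetPset.
    apply: subset_itvr; rewrite bnd_simp lerD2l ler_wpM2l ?subr_ge0 ?(ltW ab)//.
    by rewrite lef_pV2 ?posrE// ler_nat.
  - move=> n; apply/measurable_EFinP.
    exact: subspace_continuous_measurable_fun.
  - move=> n x /=; rewrite in_itv/= => /andP[ux xb].
    by rewrite lee_fin f0// xb (lt_le_trans (au n)).
apply/cvg_lim => //; under eq_fun do rewrite intE.
apply: cvg_EFin; first exact: nearW.
apply: cvgB; first exact: cvg_cst.
by move/cvg_at_rightP : Fa => /(_ u); apply.
Qed.

(** * Invariance of the integral under reflection *)

(** By uniqueness of Lebesgue measure it suffices to test the intervals []a, b]]; their preimages
    swap the open and closed ends but keep the length. *)
Lemma pushforward_reflection (R : realType) (c : R) (A : set R) : measurable A ->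
  pushforward lebesgue_measure
    ((fun x => c - x) : measurableTypeR R -> measurableTypeR R) A =
  lebesgue_measure A.
Proof.
move=> mA.
have mphi : measurable_fun [set: measurableTypeR R]
    ((fun x => c - x) : measurableTypeR R -> measurableTypeR R).
  by apply: measurable_funB => //; exact: measurable_cst.
pose phi := HB.pack ((fun x => c - x) : measurableTypeR R -> measurableTypeR R)
  (isMeasurableFun.Build _ _ _ _ _ mphi) : {mfun _ >-> _}.
apply/esym.
apply: (@lebesgue_measure_unique R (pushforward lebesgue_measure phi)) => //= _ [[a b]] _ <-.
rewrite /pushforward.
have -> : (fun x => c - x) @^-1` `]a, b]%classic = `[c - b, c - a[%classic.
  apply/seteqP; split => x /=; rewrite !in_itv/=.
    by move=> /andP[? ?]; apply/andP; split; lra.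
  by move=> /andP[? ?]; apply/andP; split; lra.
rewrite /= !lebesgue_measure_itv/= !lte_fin ltrD2l ltrN2.
case: ifPn => // _; congr EFin; ring.
Qed.

Lemma Rintegral_reflection (R : realType) (g : R -> R) (a b : R) :
  measurable_fun `[a, b] g ->
  lebesgue_measure.-integrable `[a, b] (EFin \o (fun x => g (a + b - x))) ->
  Rintegral lebesgue_measure `[a, b]%classic g =
  Rintegral lebesgue_measure `[a, b]%classic (fun x => g (a + b - x)).
Proof.
move=> mg ig; pose D := `[a, b]%classic : set (measurableTypeR R).
pose phi : measurableTypeR R -> measurableTypeR R := fun x => a + b - x.
(* Extension by zero makes the integrand measurable on the whole line, as the change of variables
   along [phi] requires; [phi] maps [D] onto itself, so nothing is lost. *)
pose k : measurableTypeR R -> \bar R := EFin \o (g \_ D).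
have phiD : phi @^-1` D = D.
  apply/seteqP; split => x /=; rewrite /D/phi/= !in_itv/= => /andP[? ?];
    by apply/andP; split; lra.
have mphi : measurable_fun [set: measurableTypeR R] phi.
  by apply: measurable_funB => //; exact: measurable_cst.
have kphi : {in D, k \o phi =1 EFin \o (fun x => g (a + b - x))}.
  move=> x; rewrite -{1}phiD inE/= => phix.
  by rewrite /k /= patchE mem_set.
have mk : measurable_fun [set: measurableTypeR R] k.
  apply/measurable_EFinP.
  have mD : measurable D by exact: measurable_itv.
  by have [+ _] := @measurable_restrictT _ _ (measurableTypeR R) _ D g mD; apply.
have ik : (@lebesgue_measure R).-integrable (phi @^-1` D) (k \o phi).
  rewrite phiD; apply: eq_integrable ig => //.
  by move=> x xD; rewrite kphi.
rewrite /Rintegral; congr fine.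
transitivity (\int[lebesgue_measure]_(x in D) k x)%E.
  by apply: eq_integral => x xD; rewrite /k/= patchE xD.
transitivity (\int[pushforward lebesgue_measure phi]_(x in D) k x)%E.
  apply: eq_measure_integral => // A mA _.
  by apply/esym/pushforward_reflection.
rewrite integral_pushforward//; last exact: measurable_itv.
rewrite phiD; by apply: eq_integral => x xD; rewrite kphi.
Qed.

(** * Real powers and the fractional weight *)

Lemma continuous_powR (R : realType) (p x : R) : 0 < x ->
  {for x, continuous (fun t : R => t `^ p)}.
Proof.
move=> x0; apply: differentiable_continuous; apply/derivable1_diffP.
by apply: derivable_powR; rewrite in_itv/= x0.
Qed.

Lemma powR_cvg_right (R : realType) (p : R) : 0 < p ->
  t `^ p @[t --> (0 : R)^'+] --> (0 : R) `^ p.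
Proof. by move=> p0; rewrite powR0 ?gt_eqF//; exact: powR_cvg0. Qed.

Lemma is_derive_shift (R : realType) (F : R -> R) (a x df : R) :
  is_derive (x - a) 1 F df -> is_derive x 1 (fun t => F (t - a)) df.
Proof.
move=> dF; have dB : is_derive x (1 : R) (fun t : R => t - a) (1 : R).
  by apply: is_derive_eq; rewrite subr0.
by have := @is_derive1_comp _ F (fun t => t - a) _ _ _ dF dB; rewrite mulr1.
Qed.

Lemma integral_powRB (R : realType) (p a x : R) : 0 < p -> a < x ->
  (\int[lebesgue_measure]_(s in `[a, x]) ((s - a) `^ (p - 1))%:E =
   ((x - a) `^ p / p)%:E)%E.
Proof.
move=> p0 ax.
have mf : measurable_fun `]a, x] (fun s : R => (s - a) `^ (p - 1)).
  apply: measurable_funTS; apply: (measurableT_comp (@measurable_powR R (p - 1))) => //.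
  exact: measurable_funB.
(* For [p < 1] the power takes the default value 0 at [s = a] and is discontinuous there; dropping
   this null point leaves the half-open interval of [ge0_FTC2_oc]. *)
rewrite -integral_itv_obnd_cbnd; last exact/measurable_EFinP.
transitivity ((x - a) `^ p / p - (a - a) `^ p / p)%:E; last first.
  by rewrite subrr powR0 ?gt_eqF// mul0r subr0.
apply: (@ge0_FTC2_oc _ (fun s => (s - a) `^ p / p)) => //.
- by move=> s _; exact: powR_ge0.
- move=> s /andP[as_ _]; apply: (@continuous_comp _ _ _ (fun s => s - a)
    (fun t => t `^ (p - 1))).
    by apply: continuousB; [exact: cvg_id|exact: cvg_cst].
  by apply: continuous_powR; rewrite subr_gt0.
- move=> s /andP[as_ _].
  apply: (@is_derive_shift _ (fun t => t `^ p / p)).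
  have -> : (s - a) `^ (p - 1) = p^-1 *: (p * (s - a) `^ (p - 1)).
    by rewrite -[RHS]/(_ * _) mulKf ?gt_eqF.
  have d : is_derive (s - a) (1 : R) (fun t : R => t `^ p) (p * (s - a) `^ (p - 1)).
    by apply: is_derive1_powR; rewrite subr_gt0.
  have := is_deriveZ p^-1 d.
  by congr is_derive; apply/funext => t; rewrite -[LHS]/(_ * _) mulrC.
- apply: cvgMr_tmp; rewrite /=.
  have /cvg_at_rightP h := powR_cvg_right _ _ p0.
  apply/cvg_at_rightP => u [ua uca].
  rewrite subrr; apply: (h (fun n => u n - a)); split.
    by move=> n; rewrite subr_gt0.
  by rewrite -(subrr a); apply: cvgB => //; exact: cvg_cst.
Qed.

(** * The Gamma integral and its functional equation *)

(** With an integer [n] above [p], one term of the exponential series, t^(n+1)/(n+1)! <= e^t, gives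
    the majorant (n+1)!/t for t >= 1. *)
Lemma powR_expR_cvgy (R : realType) (p : R) : t `^ p * expR (- t) @[t --> +oo] --> (0 : R).
Proof.
pose n := Num.bound `|p|.
have pn : p <= n%:R by rewrite (le_trans (ler_norm p))// ltW// archi_boundP.
apply: (@squeeze_cvgr _ _ _ _ (cst 0) (fun t : R => n.+1`!%:R * t^-1)).
- near=> t.
  have t1 : 1 <= t by near: t; exact: nbhs_pinfty_ge.
  have t0 : 0 < t by rewrite (lt_le_trans _ t1).
  rewrite mulr_ge0 ?powR_ge0 ?expR_ge0//=.
  rewrite expRN ler_pdivrMr ?expR_gt0//.
  apply: (@le_trans _ _ (t ^+ n)).
    by rewrite -(powR_mulrn n (ltW t0)) ler_powR.
  have f0 : 0 < n.+1`!%:R :> R by rewrite ltr0n fact_gt0.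
  have : t ^+ n.+1 / n.+1`!%:R <= expR t.
    by apply: le_trans (expR_ge1Dxn n (ltW t0)); rewrite lerDr.
  rewrite ler_pdivrMr// exprSr => h.
  by rewrite mulrAC ler_pdivlMr// [leRHS]mulrC.
- exact: cvg_cst.
- rewrite -(mulr0 (n.+1`!%:R)); apply: cvgMl_tmp.
  by apply/gtr0_cvgV0; [exact: nbhs_pinfty_gt|exact: cvg_id].
Unshelve. all: end_near. Qed.

Lemma is_derive_powR_expR (R : realType) (p t : R) : 0 < t ->
  is_derive t 1 (fun t : R => t `^ p * expR (- t))
    (t `^ (p - 1) * expR (- t) * (p - t)).
Proof.
move=> t0.
have dP : is_derive t (1 : R) (fun t : R => t `^ p) (p * t `^ (p - 1)).
  exact: is_derive1_powR.
have dE : is_derive t (1 : R) (fun t : R => expR (- t)) (- expR (- t)).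
  have dN : is_derive t (1 : R) (fun t : R => - t) (- 1 : R).
    exact: is_deriveN.
  have := @is_derive1_comp _ expR (fun t => - t) _ _ _ (is_derive_expR (- t)) dN.
  by rewrite mulrN1.
apply: is_derive_eq (is_deriveM dP dE) _.
rewrite -![_ *: _]/(_ * _) powRB ?(gt_eqF t0) ?implybT// powRr1 ?ltW//.
by field; rewrite gt_eqF.
Qed.

Lemma continuous_powR_expR (R : realType) (p t : R) : 0 < t ->
  {for t, continuous (fun t : R => t `^ (p - 1) * expR (- t) * (p - t))}.
Proof.
move=> t0; apply: continuousM; first apply: continuousM.
- exact: continuous_powR.
- apply: (@continuous_comp _ _ _ -%R expR); last exact: continuous_expR.
  exact: continuousN.
- by apply: continuousB; [exact: cvg_cst|exact: cvg_id].
Qed.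

Lemma measurable_powR_expR (R : realType) (p : R) (D : set R) :
  measurable_fun D (fun t : R => t `^ p * expR (- t)).
Proof.
apply: measurable_funTS; apply: measurable_funM.
  exact: measurable_powR.
by apply: (measurableT_comp (@measurable_expR R)); exact: measurable_funN.
Qed.

Lemma measurable_gamma_deriv (R : realType) (p : R) (D : set R) :
  measurable_fun D (fun t : R => t `^ (p - 1) * expR (- t) * (p - t)).
Proof.
apply: measurable_funM; first exact: measurable_powR_expR.
by apply: measurable_funTS; apply: measurable_funB => //; exact: measurable_cst.
Qed.

Lemma powR_expR_cvg_right (R : realType) (p a : R) : 0 < p -> 0 <= a ->
  t `^ p * expR (- t) @[t --> a^'+] --> a `^ p * expR (- a).
Proof.
move=> p0; rewrite le_eqVlt => /predU1P[<-|a0].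
  apply: cvgM; first exact: powR_cvg_right.
  apply: cvg_at_right_filter; apply: (@continuous_comp _ _ _ -%R expR).
    exact: continuousN.
  exact: continuous_expR.
apply: cvg_at_right_filter; apply: cvgM; first exact: continuous_powR.
apply: (@continuous_comp _ _ _ -%R expR); first exact: continuousN.
exact: continuous_expR.
Qed.

(** Up to [p] the derivative is nonnegative, and the primitive t^p e^(-t) vanishes at 0. *)
Lemma integral_gamma_derivl (R : realType) (p : R) : 0 < p ->
  (\int[lebesgue_measure]_(t in `]0%R, p])
     (t `^ (p - 1) * expR (- t) * (p - t))%:E = (p `^ p * expR (- p))%:E)%E.
Proof.
move=> p0; transitivity (p `^ p * expR (- p) - 0 `^ p * expR (- 0))%:E; last first.
  by rewrite powR0 ?gt_eqF// mul0r subr0.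
apply: (@ge0_FTC2_oc _ (fun t => t `^ p * expR (- t))) => //.
- move=> t /andP[t0 tp].
  by rewrite mulr_ge0 ?subr_ge0// mulr_ge0 ?powR_ge0 ?expR_ge0.
- by move=> t /andP[t0 _]; exact: continuous_powR_expR.
- by move=> t /andP[t0 _]; exact: is_derive_powR_expR.
- exact: powR_expR_cvg_right.
Qed.

(** Beyond [p] the derivative is nonpositive and the primitive tends to 0 at infinity, so only the
    boundary term at [a] survives. The endpoint is left free: integrability of the Gamma integrand
    takes [p + 1], the functional equation takes [p]. *)
Lemma integral_gamma_derivr (R : realType) (p a : R) : 0 < p -> p <= a ->
  (\int[lebesgue_measure]_(t in `]a, +oo[)
     (t `^ (p - 1) * expR (- t) * (p - t))%:E = (- (a `^ p * expR (- a)))%:E)%E.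
Proof.
move=> p0 pa; have a0 : 0 < a by rewrite (lt_le_trans p0).
rewrite integral_itv_obnd_cbnd; last first.
  by apply/measurable_EFinP; exact: measurable_gamma_deriv.
rewrite (@le0_continuous_FTC2y _ _ (fun t => t `^ p * expR (- t)) _ 0).
- by rewrite sub0e.
- move=> t at_; rewrite mulr_ge0_le0 ?subr_le0 ?(le_trans pa)//.
  by rewrite mulr_ge0 ?powR_ge0 ?expR_ge0.
- apply: continuous_in_subspaceT => t; rewrite inE/= in_itv/= andbT => at_.
  by apply: continuous_powR_expR; rewrite (lt_le_trans a0).
- exact: powR_expR_cvgy.
- by apply: powR_expR_cvg_right => //; exact: ltW.
- by move=> t at_; have [] := is_derive_powR_expR _ p t (lt_trans a0 at_).
- move=> t; rewrite in_itv/= andbT => at_.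
  have d := is_derive_powR_expR _ p t (lt_trans a0 at_).
  by rewrite derive1E derive_val.
Qed.

Lemma integrable_powRB (R : realType) (p a x : R) : 0 < p -> a < x ->
  lebesgue_measure.-integrable `[a, x]
    (EFin \o (fun s : R => (s - a) `^ (p - 1))).
Proof.
move=> p0 ax; have mf : measurable_fun `[a, x] (fun s : R => (s - a) `^ (p - 1)).
  apply: measurable_funTS.
  apply: (measurableT_comp (@measurable_powR R (p - 1))) => //.
  exact: measurable_funB.
apply/integrableP; split; first exact/measurable_EFinP.
(* The integral is the difference of those of the positive and negative parts, so a finite value
   makes both finite. *)
rewrite integral_fin_num_abs//.
by rewrite integral_powRB.
Qed.

(* For [t > p + 1] the absolute value of the derivative of [t^p e^(-t)] dominates. *)
Lemma integrable_gamma (R : realType) (p : R) : 0 < p ->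
  lebesgue_measure.-integrable `]0, +oo[
    (EFin \o (fun t : R => t `^ (p - 1) * expR (- t))).
Proof.
move=> p0; pose b := p + 1; have b0 : 0 < b by rewrite addr_gt0.
(* Near 0 the factor e^(-t) is at most 1, so the pure power dominates. *)
have il : lebesgue_measure.-integrable `]0, b]
    (EFin \o (fun t : R => t `^ (p - 1) * expR (- t))).
  apply: (@le_integrable _ (measurableTypeR R) R lebesgue_measure _ _ _ (EFin \o (fun s : R => (s - 0) `^ (p - 1)))) => //.
  - by apply/measurable_EFinP; exact: measurable_powR_expR.
  - move=> t /=; rewrite in_itv/= => /andP[t0 _].
    rewrite lee_fin normrM subr0 ger_pMr ?normr_gt0 ?gt_eqF ?powR_gt0//.
    by rewrite ger0_norm ?expR_ge0// -expR0 ler_expR lerNl oppr0 ltW.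
  - apply: integrableS (integrable_powRB _ _ _ _ p0 b0) => //.
    exact: subset_itv_oc_cc.
have ir : lebesgue_measure.-integrable `]b, +oo[
    (EFin \o (fun t : R => t `^ (p - 1) * expR (- t))).
  apply: (@le_integrable _ (measurableTypeR R) R lebesgue_measure _ _ _
    (EFin \o (fun t : R => t `^ (p - 1) * expR (- t) * (p - t)))) => //.
  - by apply/measurable_EFinP; exact: measurable_powR_expR.
  - move=> t /=; rewrite in_itv/= andbT /b => bt.
    rewrite lee_fin (normrM _ (p - t)) ler_peMr// distrC.
    by rewrite ler_normr; apply/orP; left; lra.
  - apply/integrableP; split.
      by apply/measurable_EFinP; exact: measurable_gamma_deriv.
    rewrite integral_fin_num_abs//; last exact: measurable_gamma_deriv.
    by rewrite integral_gamma_derivr// lerDl.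
have -> : `]0, +oo[%classic = `]0, b] `|` `]b, +oo[ :> set R.
  by apply: itv_bndbnd_setU; rewrite bnd_simp// ltW.
have mg D := measurable_powR_expR R (p - 1) D.
apply/integrableP; split; first by apply/measurable_EFinP; exact: mg.
rewrite integral_setU//.
- case/integrableP : il => _ il; case/integrableP : ir => _ ir.
  exact: lte_add_pinfty.
- apply: measurableT_comp => //; apply/measurable_EFinP; exact: mg.
- apply/disj_set2P; rewrite -subset0 => t [] /=; rewrite !in_itv/= andbT.
  by move=> /andP[_ tb] /(le_lt_trans tb); rewrite ltxx.
Qed.

(** On []0, p]], [p] times the integrand dominates the derivative of t^p e^(-t), whose integral
    there is p^p e^(-p) > 0. *)
Lemma Gamma_gt0 (R : realType) (p : R) : 0 < p -> 0 < Gamma p.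
Proof.
move=> p0; have ig := integrable_gamma _ _ p0.
rewrite /Gamma /Rintegral fine_gt0//; apply/andP; split; last exact: integrable_lty.
have g0 (t : R) : 0 <= t `^ (p - 1) * expR (- t).
  by rewrite mulr_ge0 ?powR_ge0 ?expR_ge0.
have mg D := measurable_powR_expR R (p - 1) D.
apply: (@lt_le_trans _ _ (\int[lebesgue_measure]_(t in `]0%R, p])
    (t `^ (p - 1) * expR (- t))%:E)%E); last first.
  apply: ge0_subset_integral => //; first by apply/measurable_EFinP; exact: mg.
    by move=> t _; rewrite lee_fin.
  by apply: subset_itvl.
rewrite -(@pmule_rgt0 _ p%:E) ?lte_fin// -ge0_integralZl//.
2: by apply/measurable_EFinP; exact: mg.
2: by move=> t _; rewrite lee_fin.
2: by rewrite lee_fin ltW.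
apply: (@lt_le_trans _ _ (p `^ p * expR (- p))%:E).
  by rewrite lte_fin mulr_gt0 ?powR_gt0 ?expR_gt0.
rewrite -integral_gamma_derivl//; apply: ge0_le_integral => //.
- move=> t /=; rewrite in_itv/= => /andP[_ tp].
  by rewrite lee_fin mulr_ge0// subr_ge0.
- by apply/measurable_EFinP; exact: measurable_gamma_deriv.
- by apply/measurable_EFinP; apply: measurable_funM => //; exact: mg.
- move=> t /=; rewrite in_itv/= => /andP[t0 _].
  by rewrite -EFinM lee_fin [leRHS]mulrC ler_wpM2l// gerBl ltW.
Qed.

Lemma GammaD1 (R : realType) (p : R) : 0 < p -> Gamma (p + 1) = p * Gamma p.
Proof.
move=> p0; have ig := integrable_gamma _ _ p0.
have ig1 : lebesgue_measure.-integrable `]0, +oo[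
    (EFin \o (fun t : R => t `^ (p + 1 - 1) * expR (- t))).
  by apply: integrable_gamma; rewrite addr_gt0.
apply/esym/eqP; rewrite -subr_eq0; apply/eqP.
have ipg : lebesgue_measure.-integrable `]0, +oo[
    (EFin \o (fun t : R => p * (t `^ (p - 1) * expR (- t)))).
  by apply: eq_integrable (integrableZl _ p ig).
rewrite /Gamma -RintegralZl// -RintegralB//.
transitivity (Rintegral lebesgue_measure `]0, +oo[%classic
    (fun t => t `^ (p - 1) * expR (- t) * (p - t))).
  apply: eq_Rintegral => t; rewrite inE/= in_itv/= andbT => t0.
  rewrite addrK -(mulr_powRB1 (ltW t0) p0); ring.
(* The two pieces contribute p^p e^(-p) and its opposite. *)
rewrite /Rintegral; have -> : `]0, +oo[%classic = `]0, p] `|` `]p, +oo[ :> set R.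
  by apply: itv_bndbnd_setU; rewrite bnd_simp// ltW.
rewrite integral_setU//.
- by rewrite integral_gamma_derivl// integral_gamma_derivr//= subrr.
- by apply/measurable_EFinP; exact: measurable_gamma_deriv.
- apply/disj_set2P; rewrite -subset0 => t [] /=; rewrite !in_itv/= andbT.
  by move=> /andP[_ tp] /(le_lt_trans tp); rewrite ltxx.
Qed.

(** * Increment bounds and the fractional trapezoid estimate *)

(** Both [B - f] and [B + f] have nonnegative derivative, hence are nondecreasing. *)
Lemma le_norm_increment (R : realType) (f B : R -> R) (a b x y : R) :
  (forall t, t \in `[a, b] -> derivable f t 1) ->
  (forall t, t \in `[a, b] -> derivable B t 1) ->
  (forall t, t \in `[a, b] -> `|derive1 f t| <= derive1 B t) ->
  a <= x -> x <= y -> y <= b -> `|f y - f x| <= B y - B x.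
Proof.
move=> df dB fB ax xy yb.
have cf : {within `[a, b], continuous f} by exact: derivable_within_continuous.
have cB : {within `[a, b], continuous B} by exact: derivable_within_continuous.
have h1 : B x - f x <= B y - f y.
  apply: (@ger0_derive1_ndecr _ (B \- f) a b) => //.
  - move=> t /subset_itv_oo_cc tab; apply: derivableB; [exact: dB|exact: df].
  - move=> t /subset_itv_oo_cc tab; rewrite derive1E deriveB; [|exact: dB|exact: df].
    by rewrite -!derive1E subr_ge0 (le_trans _ (fB _ tab))// ler_norm.
  - by move=> t; apply: continuousB; [exact: cB|exact: cf].
have h2 : B x + f x <= B y + f y.
  apply: (@ger0_derive1_ndecr _ (B \+ f) a b) => //.
  - move=> t /subset_itv_oo_cc tab; apply: derivableD; [exact: dB|exact: df].
  - move=> t /subset_itv_oo_cc tab; rewrite derive1E deriveD; [|exact: dB|exact: df].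
    by rewrite -!derive1E -lerBlDr sub0r (le_trans _ (fB _ tab))// -normrN ler_norm.
  - by move=> t; apply: continuousD; [exact: cB|exact: cf].
by rewrite ler_norml; apply/andP; split; lra.
Qed.

Lemma integrable_powRB_bounded (R : realType) (p a b M : R) (h : R -> R) :
  0 < p -> a < b -> measurable_fun `[a, b] h ->
  (forall s, s \in `[a, b] -> `|h s| <= M) ->
  lebesgue_measure.-integrable `[a, b]
    (EFin \o (fun s : R => (s - a) `^ (p - 1) * h s)).
Proof.
move=> p0 ab mh hM; have iw := integrable_powRB _ _ _ _ p0 ab.
have iM : lebesgue_measure.-integrable `[a, b]
    (EFin \o (fun s : R => M * (s - a) `^ (p - 1))).
  by apply: eq_integrable (integrableZl _ M iw).
apply: (@le_integrable _ (measurableTypeR R) R lebesgue_measure _ _ _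
  (EFin \o (fun s : R => M * (s - a) `^ (p - 1)))) => //.
- apply/measurable_EFinP; apply: measurable_funM => //.
  by apply/measurable_EFinP; exact: (measurable_int _ iw).
- move=> s sab; rewrite /= lee_fin normrM mulrC.
  by rewrite [in leRHS]normrM ler_wpM2r// (le_trans (hM _ sab))// ler_norm.
Qed.

Lemma Rintegral_powRB (R : realType) (p a x : R) : 0 < p -> a < x ->
  Rintegral lebesgue_measure `[a, x]%classic (fun s => (s - a) `^ (p - 1)) =
  (x - a) `^ p / p.
Proof. by move=> p0 ax; rewrite /Rintegral integral_powRB. Qed.

(** The defect is unchanged by the reflection of [[a, b]], so the assumed bound [K * (s - a)] also
    gives [K * (b - s)]. Using each on the half where it is the smaller produces the factor 1 -
    2^(-p). *)
Lemma fractional_trapezoid_bound (R : realType) (f : R -> R) (p a b M K : R) :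
  0 < p -> a < b -> 0 <= K ->
  measurable_fun `[a, b] f ->
  (forall s, s \in `[a, b] -> `|f s| <= M) ->
  (forall s, s \in `[a, b] ->
    `|f a + f b - (f s + f (a + b - s))| <= K * (s - a)) ->
  `| (f a + f b) * (b - a) `^ p / p
     - (Rintegral lebesgue_measure `[a, b]%classic
          (fun s => (b - s) `^ (p - 1) * f s)
        + Rintegral lebesgue_measure `[a, b]%classic
          (fun s => (s - a) `^ (p - 1) * f s)) |
  <= K * (b - a) `^ (p + 1) * (1 - (2 `^ p)^-1) / (p * (p + 1)).
Proof.
move=> p0 ab K0 mf fM fK.
pose r (s : R) := a + b - s.
have rI s : s \in `[a, b] -> r s \in `[a, b].
  by rewrite !in_itv/= /r => /andP[? ?]; apply/andP; split; lra.
pose w (s : R) := (s - a) `^ (p - 1).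
have iw : lebesgue_measure.-integrable `[a, b] (EFin \o w).
  exact: integrable_powRB.
have mfr : measurable_fun `[a, b] (f \o r).
  apply: (measurable_comp _ _ mf) => //.
  - by move=> _ [s + <-]; exact: rI.
  - by apply: measurable_funTS; apply: measurable_funB => //; exact: measurable_cst.
have mw : measurable_fun `[a, b] w.
  by apply/measurable_EFinP; exact: (measurable_int _ iw).
have iwf : lebesgue_measure.-integrable `[a, b] (EFin \o (fun s => w s * f s)).
  exact: (@integrable_powRB_bounded _ _ _ _ M).
have iwfr : lebesgue_measure.-integrable `[a, b]
    (EFin \o (fun s => w s * (f \o r) s)).
  by apply: (@integrable_powRB_bounded _ _ _ _ M) => // s sab; apply/fM/rI.
have wr s : (b - r s) `^ (p - 1) = w s by rewrite /w /r; congr (_ `^ _); ring.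
have -> : Rintegral lebesgue_measure `[a, b]%classic
      (fun s => (b - s) `^ (p - 1) * f s) =
    Rintegral lebesgue_measure `[a, b]%classic (fun s => w s * (f \o r) s).
  rewrite Rintegral_reflection.
  - by apply: eq_Rintegral => s _; rewrite -/(r s) wr.
  - apply: measurable_funM => //; apply: measurable_funTS.
    apply: (measurableT_comp (@measurable_powR R (p - 1))) => //.
    by apply: measurable_funB => //; exact: measurable_cst.
  - by apply: eq_integrable iwfr => // s _ /=; rewrite -/(r s) wr.
pose D s := f a + f b - (f s + f (r s)).
have iwD : lebesgue_measure.-integrable `[a, b] (EFin \o (fun s => w s * D s)).
  apply: (@integrable_powRB_bounded _ _ _ _ (K * (b - a))) => //.
    apply: measurable_funB; first exact: measurable_cst.
    exact: measurable_funD.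
  move=> s sab; rewrite (le_trans (fK _ sab))// ler_wpM2l//.
  by move: sab; rewrite in_itv/= => /andP[_ ?]; rewrite lerD2r.
(* The weight [w] has total mass (b - a)^p / p, which absorbs the endpoint term into the
   integral. *)
have -> : (f a + f b) * (b - a) `^ p / p
    - (Rintegral lebesgue_measure `[a, b]%classic (fun s => w s * (f \o r) s)
       + Rintegral lebesgue_measure `[a, b]%classic (fun s => w s * f s)) =
    Rintegral lebesgue_measure `[a, b]%classic (fun s => w s * D s).
  rewrite -mulrA -Rintegral_powRB// -RintegralZl// -RintegralD//.
  rewrite -RintegralB//.
  - by apply: eq_Rintegral => s _; rewrite /D /w /=; ring.
  - by apply: eq_integrable (integrableZl _ (f a + f b) iw).
  - by apply: eq_integrable (integrableD _ iwfr iwf).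
apply: (le_trans (le_normr_Rintegral _ iwD)) => //.
have w0 s : 0 <= w s by exact: powR_ge0.
pose m := (a + b) / 2.
have am : a < m by rewrite /m; lra.
have mb : m < b by rewrite /m; lra.
have ww s : a <= s -> w s * (s - a) = (s - a) `^ p.
  by move=> as_; rewrite mulrC mulr_powRB1// subr_ge0.
have p10 : 0 < p + 1 by rewrite addr_gt0.
(* The unsimplified exponent lets the lemmas on the weight apply with [p + 1] in place of [p]. *)
pose v (s : R) := (s - a) `^ (p + 1 - 1).
have vE s : v s = (s - a) `^ p by rewrite /v addrK.
have iv c : a < c -> lebesgue_measure.-integrable `[a, c] (EFin \o v).
  by move=> ac; exact: integrable_powRB.
have iwc c : a < c -> lebesgue_measure.-integrable `[a, c] (EFin \o w).
  by move=> ac; exact: integrable_powRB.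
have iKv : lebesgue_measure.-integrable `[a, m] (EFin \o (fun s => K * v s)).
  by apply: eq_integrable (integrableZl _ K (iv _ am)).
(* On [[a, b]] this is [w s * (b - s)], written through powers of [s - a] whose integrals are
   known. *)
pose z s := (b - a) * w s - v s.
have ibw : lebesgue_measure.-integrable `[a, b] (EFin \o (fun s => (b - a) * w s)).
  by apply: eq_integrable (integrableZl _ (b - a) iw).
have iz : lebesgue_measure.-integrable `[a, b] (EFin \o z).
  by apply: eq_integrable (integrableB _ ibw (iv _ ab)).
have iKz : lebesgue_measure.-integrable `[a, b] (EFin \o (fun s => K * z s)).
  by apply: eq_integrable (integrableZl _ K iz).
have inD : lebesgue_measure.-integrable `[a, b] (EFin \o (fun s => `|w s * D s|)).
  by apply: eq_integrable (integrable_abse iwD).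
have sm : `[a, m]%classic `<=` `[a, b]%classic.
  by apply: subset_itvl; rewrite bnd_simp ltW.
have sb : `]m, b]%classic `<=` `[a, b]%classic.
  by apply: subset_itvr; rewrite bnd_simp ltW.
have Dl s : s \in `[a, m] -> `|w s * D s| <= K * v s.
  rewrite in_itv/= => /andP[as_ sm_].
  rewrite normrM (ger0_norm (w0 s)) vE -ww// mulrCA ler_wpM2l//.
  by apply: fK; rewrite in_itv/= as_ (le_trans sm_)// ltW.
have Dr s : s \in `]m, b] -> `|w s * D s| <= K * z s.
  rewrite in_itv/= => /andP[ms_ sb_].
  have as_ : a <= s by rewrite ltW// (lt_trans am).
  have -> : z s = w s * (b - s) by rewrite /z vE -ww//; ring.
  rewrite normrM (ger0_norm (w0 s)) mulrCA ler_wpM2l//.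
  (* The bound is taken at the reflected point, where [r s - a = b - s] and the defect is the
     same. *)
  have rab : r s \in `[a, b] by apply: rI; rewrite in_itv/= as_.
  have := fK _ rab; rewrite -/(r (r s)).
  have -> : r (r s) = s by rewrite /r; ring.
  have -> : r s - a = b - s by rewrite /r; ring.
  by rewrite [f (r s) + _]addrC.
(* Integrals over the right half become differences of integrals starting at [a], the only ones
   computed above. *)
have split g : lebesgue_measure.-integrable `[a, b] (EFin \o g) ->
    Rintegral lebesgue_measure `]m, b]%classic g =
    Rintegral lebesgue_measure `[a, b]%classic g -
    Rintegral lebesgue_measure `[a, m]%classic g.
  by move=> ig; rewrite Rintegral_itvB// bnd_simp ltW.
rewrite -[leLHS](subrK (Rintegral lebesgue_measure `[a, m]%classic
   (fun s => `|w s * D s|))) -split//.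
have hl : Rintegral lebesgue_measure `[a, m]%classic (fun s => `|w s * D s|) <=
    K * ((m - a) `^ (p + 1) / (p + 1)).
  rewrite -Rintegral_powRB// -RintegralZl//; last exact: iv.
  apply: le_Rintegral => //; first exact: integrableS inD.
have hr : Rintegral lebesgue_measure `]m, b]%classic (fun s => `|w s * D s|) <=
    K * ((b - a) * ((b - a) `^ p / p - (m - a) `^ p / p)
      - ((b - a) `^ (p + 1) / (p + 1) - (m - a) `^ (p + 1) / (p + 1))).
  rewrite -!Rintegral_powRB// -/w -/v -!split//; last exact: iv.
  have iwr : lebesgue_measure.-integrable `]m, b] (EFin \o w) by exact: integrableS iw.
  have ivr : lebesgue_measure.-integrable `]m, b] (EFin \o v).
    by apply: integrableS (iv _ ab).
  rewrite -RintegralZl// -RintegralB//; last first.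
    exact: integrableS ibw.
  rewrite -RintegralZl//; last exact: integrableS iz.
  apply: le_Rintegral => //; [exact: integrableS inD|exact: integrableS iKz].
apply: (le_trans (lerD hr hl)).
have -> : m - a = (b - a) * 2^-1 by rewrite /m; field.
have h0 : 0 < b - a by rewrite subr_gt0.
have pD1 x : 0 < x -> x `^ (p + 1) = x `^ p * x.
  by move=> x0; rewrite powRD ?powRr1 ?ltW// gt_eqF// implybT.
rewrite !pD1// ?mulr_gt0// powRM ?(ltW h0)//.
have -> : 2^-1 `^ p = (2 `^ p)^-1 :> R.
  by rewrite -powR_inv1// -powRrM mulN1r powRN.
rewrite le_eqVlt; apply/orP; left; apply/eqP.
have t0 : 2 `^ p != 0 :> R by rewrite gt_eqF// powR_gt0.
by field; rewrite t0 !gt_eqF.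
Qed.

(** * The inequality for preinvex derivatives *)

Theorem theorem2p3 (R : realType) (A : set R) (eta : R -> R -> R) (a b : R)
    (f : R -> R) (alpha : R) :
  open A -> invex A eta -> A a -> A b -> a < a + eta b a ->
  (forall x, A x -> derivable f x 1) ->
  lebesgue_measure.-integrable `[a, a + eta b a] (EFin \o (derive1 f)) ->
  preinvex A eta (fun x => `|(derive1 f) x|) ->
  0 < alpha ->
  `| (f a + f (a + eta b a)) / 2
     - Gamma (alpha + 1) / (2 * eta b a `^ alpha) *
       (RL_left alpha f a (a + eta b a) + RL_right alpha f (a + eta b a) a) |
  <= eta b a / (2 * (alpha + 1)) * (1 - (2 `^ alpha)^-1) * (`|(derive1 f) a| + `|(derive1 f) b|).
Proof.
move=> _ invA Aa Ab aaeta df _ pre al0.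
set h := eta b a; set d := a + h.
have h0 : 0 < h by rewrite -(ltrDl a).
set P := `|derive1 f a|; set Q := `|derive1 f b|.
(* [B] is the antiderivative, vanishing at [a], of the affine bound on [|f'|]. *)
pose B (t : R) : R := P * (t - a) + (Q - P) / (2 * h) * (t - a) ^+ 2.
have dB t : is_derive t (1 : R) B (P + (Q - P) / h * (t - a)).
  rewrite /B; apply: is_derive_eq.
  rewrite /GRing.scale/=; field; rewrite gt_eqF//.
(* Each point of [[a, d]] lies on the invex path from [a] towards [b]; this places it in [A] and
   makes preinvexity applicable. *)
have param t : t \in `[a, d] -> 0 <= (t - a) / h <= 1 /\ a + (t - a) / h * h = t.
  rewrite in_itv/= => /andP[at_ td]; split; last by field; rewrite gt_eqF.
  by rewrite divr_ge0 ?subr_ge0 ?(ltW h0)//= ler_pdivrMr// mul1r lerBlDl.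
have dfd t : t \in `[a, d] -> derivable f t 1.
  move=> /param [t01 tE]; apply: df; rewrite -tE; exact: invA.
have fB t : t \in `[a, d] -> `|derive1 f t| <= derive1 B t.
  move=> /param [t01 tE]; rewrite (@derive1E _ _ B) derive_val.
  have := pre _ _ Aa Ab _ t01; rewrite -/h tE => /le_trans; apply.
  rewrite le_eqVlt; apply/orP; left; apply/eqP.
  by rewrite -/P -/Q; field; rewrite gt_eqF.
have incr x y : a <= x -> x <= y -> y <= d -> `|f y - f x| <= B y - B x.
  by move=> ax xy yd; apply: (@le_norm_increment _ f B a d).
have cf : {within `[a, d], continuous f} by exact: derivable_within_continuous.
have mf : measurable_fun `[a, d] f by exact: subspace_continuous_measurable_fun.
have fM s : s \in `[a, d] -> `|f s| <= `|f a| + (B d - B a).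
  rewrite in_itv/= => /andP[as_ sd].
  have h1 := incr a s (lexx _) as_ sd.
  have h2 := le_trans (normr_ge0 _) (incr s d as_ sd (lexx _)).
  have := ler_normD (f a) (f s - f a); rewrite addrC subrK; lra.
have fK s : s \in `[a, d] -> `|f a + f d - (f s + f (a + d - s))| <= (P + Q) * (s - a).
  rewrite in_itv/= => /andP[as_ sd].
  have h1 := incr a s (lexx _) as_ sd.
  have h2 : `|f d - f (a + d - s)| <= B d - B (a + d - s).
    by apply: incr; lra.
  (* The quadratic terms of the two increments of [B] cancel, leaving a bound linear in [s - a] and
     symmetric in [P] and [Q]. *)
  have -> : (P + Q) * (s - a) = (B s - B a) + (B d - B (a + d - s)).
    by rewrite /B /d; field; rewrite gt_eqF.
  have -> : f a + f d - (f s + f (a + d - s)) = - (f s - f a) + (f d - f (a + d - s)).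
    by ring.
  by rewrite (le_trans (ler_normD _ _))// normrN lerD.
have PQ0 : 0 <= P + Q by exact: addr_ge0 (normr_ge0 _) (normr_ge0 _).
have := fractional_trapezoid_bound _ _ _ _ _ _ _ al0 aaeta PQ0 mf fM fK.
rewrite /RL_left /RL_right GammaD1// -/h -/d.
have G0 := Gamma_gt0 _ _ al0.
set I1 := Rintegral _ _ _; set I2 := Rintegral _ _ _.
have -> : d - a = h by rewrite /d; ring.
have ha : 0 < h `^ alpha by rewrite powR_gt0.
have -> : h `^ (alpha + 1) = h `^ alpha * h.
  by rewrite powRD ?powRr1 ?(ltW h0)// (gt_eqF h0) implybT.
set T := (1 - _); set G := Gamma alpha in G0 *; set H := h `^ alpha in ha *.
have c0 : 0 <= alpha / (2 * H) by rewrite divr_ge0 ?mulr_ge0 ?ltW.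
(* The functional equation has turned the prefactor into [alpha * G], whose [G] cancels the
   normalisation of both fractional integrals. *)
have -> : (f a + f d) / 2 - alpha * G / (2 * H) * (G^-1 * I1 + G^-1 * I2) =
    alpha / (2 * H) * ((f a + f d) * H / alpha - (I1 + I2)).
  by field; rewrite !gt_eqF.
rewrite normrM (ger0_norm c0) => le12.
apply: (le_trans (ler_wpM2l c0 le12)).
rewrite le_eqVlt; apply/orP; left; apply/eqP.
by field; rewrite !gt_eqF// addr_gt0.
Qed.
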